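(* For every integer $k\geq 0$, the number of uniquely sorted permutations in $S_{2k+1}$ is exactly $A_{k+1}$, where $(A_m)_{m\ge 1}$ is Lassalle's sequence.
   Context: Lassalle's sequence $(A_m)_{m\geq 1}$ is defined by $A_1=1$ and $$A_m=(-1)^{m-1}C_m+\sum_{j=1}^{m-1}(-1)^{j-1}\binom{2m-1}{2m-2j-1}A_{m-j}C_j,$$ where $C_n=\frac{1}{n+1}\binom{2n}{n}$ is the $n$-th Catalan number. $S_n$ is the set of permutations of $\{1,\ldots,n\}$, written as words $\pi=\pi_1\cdots\pi_n$. The (West) stack-sorting map $s:S_n\to S_n$ is defined by the following procedure on an input $\pi=\pi_1\cdots\pi_n$, using an initially empty vertical stack. At any point in time, if there is a next entry of the input and either it is smaller than the entry at the top of the stack or the stack is empty, then that next entry is placed on top of the stack. Otherwise, the entry at the top of the stack is removed and appended to the end of the output. The procedure terminates when the output has length $n$, and $s(\pi)$ is this output. The fertility of $\pi\in S_n$ is $|s^{-1}(\pi)|$. A permutation is uniquely sorted if its fertility is $1$. *)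

(* Defs.v *)
From mathcomp Require Import all_boot all_order all_fingroup all_algebra.

Set Implicit Arguments.
Unset Strict Implicit.
Unset Printing Implicit Defensive.

Import Order.TTheory GRing.Theory Num.Theory.

(* The division is exact, see [catalanE]. *)
Definition catalan (n : nat) : nat := 'C(2 * n, n) %/ n.+1.

Lemma catalanE n : (n.+1 * catalan n = 'C(2 * n, n))%N.
Proof.
rewrite /catalan mulnC divnK //.
have E : (n.+1 * 'C(2 * n, n.+1) = n * 'C(2 * n, n))%N.
  by rewrite mul_bin_left mul2n -addnn addnK.
have -> : ('C(2 * n, n) = n.+1 * 'C(2 * n, n) - n.+1 * 'C(2 * n, n.+1))%N.
  by rewrite E mulSn addnK.
by rewrite -mulnBr dvdn_mulr.
Qed.

(* Well-founded recursion on m, with [fuel >= m]; see [lassalle1] and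
   [lassalleE] for the defining equations. *)
Fixpoint lassalle_rec (fuel m : nat) : int :=
  if fuel is fuel'.+1 then
    ((-1) ^+ (m - 1) * (catalan m)%:Z +
     \sum_(1 <= j < m)
        (-1) ^+ (j - 1) * ('C(2 * m - 1, 2 * m - 2 * j - 1))%:Z
        * lassalle_rec fuel' (m - j) * (catalan j)%:Z)%R
  else 0%R.

(* The junk value at 0 is 0. *)
Definition lassalle (m : nat) : int := lassalle_rec m m.

Lemma lassalle_rec_fuel f m : (0 < m <= f)%N -> lassalle_rec f m = lassalle m.
Proof.
have [n] := ubnP f; elim: n f m => // n IHn f [|m] //= le_f_n /= le_m_f.
rewrite /lassalle; case: f le_f_n le_m_f => //= f le_f_n le_m_f.
congr (_ + _)%R; apply: eq_big_nat => j /andP[j_gt0 lt_j_m].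
have jm : (0 < m.+1 - j <= m)%N by rewrite subn_gt0 lt_j_m leq_subLR -add1n leq_add2r.
rewrite !IHn //; first exact: leq_trans le_m_f _.
by case/andP: jm => -> /leq_trans->.
Qed.

Lemma lassalle1 : lassalle 1 = 1%R.
Proof. by rewrite /lassalle /= big_geq. Qed.

Lemma lassalleE m : (0 < m)%N ->
  lassalle m =
    ((-1) ^+ (m - 1) * (catalan m)%:Z +
     \sum_(1 <= j < m)
        (-1) ^+ (j - 1) * ('C(2 * m - 1, 2 * m - 2 * j - 1))%:Z
        * lassalle (m - j) * (catalan j)%:Z)%R.
Proof.
case: m => // m _; rewrite {1}/lassalle /=.
congr (_ + _)%R; apply: eq_big_nat => j /andP[j_gt0 lt_j_m].
rewrite lassalle_rec_fuel // subn_gt0 lt_j_m /= leq_subLR -add1n.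
by rewrite leq_add2r.
Qed.

(* The word p_1 ... p_n over {1, ..., n} of a permutation of
   'I_n = {0, ..., n - 1}. *)
Definition word (n : nat) (p : 'S_n) : seq nat :=
  [seq (p i).+1 | i <- enum 'I_n].

(* A state is (remaining input, stack with its top first, output so far). *)
Definition stack_step (st : seq nat * seq nat * seq nat) :=
  let: (inp, stk, out) := st in
  match inp, stk with
  | x :: inp', [::] => (inp', [:: x], out)
  | x :: inp', y :: stk' =>
      if (x < y)%N then (inp', x :: stk, out) else (inp, stk', rcons out y)
  | [::], y :: stk' => ([::], stk', rcons out y)
  | [::], [::] => st
  end.

(* Every letter is pushed once and popped once, so the output is complete after
   exactly [2 * size w] steps. *)
Definition stack_sort (w : seq nat) : seq nat :=
  (iter (2 * size w) stack_step (w, [::], [::])).2.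

Lemma perm_stack_sort w : perm_eq (stack_sort w) w.
Proof.
pose tot (st : seq nat * seq nat * seq nat) := st.1.1 ++ st.1.2 ++ st.2.
pose mu (st : seq nat * seq nat * seq nat) := (2 * size st.1.1 + size st.1.2)%N.
have step_tot st : perm_eq (tot (stack_step st)) (tot st).
  case: st => [[[|x i] [|y s]] o] //=; apply/seq.permP => a; rewrite /tot /=.
  - by rewrite count_cat -cats1 !count_cat /= addn0 addnA addnC.
  - by rewrite count_cat /= count_cat addnCA.
  - case: ifP => _; rewrite /= !count_cat /= -?cats1 ?count_cat /=.
      by rewrite addnCA.
    by rewrite addn0 (addnA (count a s)) (addnC _ (nat_of_bool (a y))).
have step_mu st : mu (stack_step st) = (mu st).-1.
  case: st => [[[|x i] [|y s]] o]; rewrite /mu !mul2n //=.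
    by rewrite addn0 addn1.
  by case: ifP => _; rewrite /= ?doubleS ?addSn ?addnS.
have iter_tot n st : perm_eq (tot (iter n stack_step st)) (tot st).
  by elim: n => //= n IHn; apply: perm_trans (step_tot _) IHn.
have iter_mu n st : mu (iter n stack_step st) = (mu st - n)%N.
  by elim: n => [|n IHn] /=; rewrite ?subn0 // step_mu IHn subnS.
rewrite /stack_sort; set n := (2 * size w)%N.
have := iter_tot n (w, [::], [::]); have := iter_mu n (w, [::], [::]).
rewrite {2}/mu /= addn0 subnn.
case: (iter _ _ _) => [[i s] o]; rewrite /mu /tot /= cats0.
by case: i s => [|? ?] [|? ?].
Qed.

Definition fertility (n : nat) (p : 'S_n) : nat :=
  #|[set q : 'S_n | stack_sort (word q) == word p]|.

Definition uniquely_sorted (n : nat) (p : 'S_n) : bool := fertility p == 1%N.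

(* Main.v *)
Require Import Defs.
From mathcomp Require Import all_boot all_order all_fingroup all_algebra.
From mathcomp Require Import zify ring.

Set Implicit Arguments.
Unset Strict Implicit.
Unset Printing Implicit Defensive.

Import Order.TTheory GRing.Theory Num.Theory.

(**
Since [s(L N R) = s(L) s(R) N] for a word with largest letter [N], a nonempty
word in the image of [s] has at most [(n - 1) / 2] descents, and it has exactly
one preimage if and only if equality holds.  Call such words good: they are the
one-letter words and the words [A B N] with [A], [B] good, [N] the largest
letter and [last A > head B]; this decomposition is unique.

Let [u(X, x)] be the number of good words on the letters [X] with first letter
[x], and let [m_(2k) = (-1)^k C_k], [m_(2k+1) = 0], so that Catalan's recurrence
reads [m_(n+1) = - sum_(i < n) m_i m_(n-1-i)].  Induction on [|X|], by removal
of the largest letter, gives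
    [sum_(L <= X) m_|X \ L| u(L, x) = m_|X_(<x)| m_|X_(>x)|].
Summing over [x] in [X] gives [sum_(L <= X) m_|X \ L| u(L) = - m_(|X|+1)], which is
Lassalle's recurrence.
*)

(** * The stack-sorting recursion *)

Lemma stack_step_all (P : pred nat) st :
  all P (st.1.1 ++ st.1.2) ->
  all P ((stack_step st).1.1 ++ (stack_step st).1.2).
Proof.
case: st => [[[|x i] [|y s]] o] //=.
- by case/andP.
- by rewrite !all_cat /= !andbT andbC.
by case: ifP => _; rewrite /= !all_cat /=;
  case: (P x); case: (P y); case: (all P i) => //=.
Qed.

(** While [L] is processed, [st] and [I] are inert: every letter of [L] is small enough to be pushed
    onto [st], and the first letter of [I] is large enough to pop whatever remains of [L]. The
    defaults [x.+1] and [x] of [head] make the hypotheses vacuous when [st] or [I] is empty. *)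
Lemma iter_stack_step_cat (L I st out : seq nat) :
  {in L, forall x, x < head x.+1 st} -> {in L, forall x, x <= head x I} ->
  iter (2 * size L) stack_step (L ++ I, st, out) = (I, st, out ++ stack_sort L).
Proof.
move=> Lst LI.
(* [mu] is the number of steps left: a push and a pop for each input letter, a pop for each stacked
   one. *)
pose mu (t : seq nat * seq nat * seq nat) := 2 * size t.1.1 + size t.1.2.
pose lift (t : seq nat * seq nat * seq nat) :=
  (t.1.1 ++ I, t.1.2 ++ st, out ++ t.2).
have step_lift t : 0 < mu t -> {subset t.1.1 ++ t.1.2 <= L} ->
    stack_step (lift t) = lift (stack_step t) /\
    mu (stack_step t) = (mu t).-1.
  case: t => [[[|x i] [|y s]] o]; rewrite /mu /lift //= => _ sub.
  - have yL : y \in L by apply: sub; rewrite inE eqxx.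
    split; last by lia.
    clear lift; case: I LI => [|z I'] LI //=; rewrite ?rcons_cat //.
    by have /= := LI _ yL; rewrite ltnNge => ->.
  - have xL : x \in L by apply: sub; rewrite inE eqxx.
    split; last by lia.
    by clear lift; case: st Lst => [|z st'] Lst //=; have /= -> := Lst _ xL.
  - by case: ifP => _; rewrite /= ?rcons_cat; split=> //; lia.
have iter_lift k : k <= 2 * size L ->
    let t := iter k stack_step (L, [::], [::]) in
    [/\ iter k stack_step (L ++ I, st, out) = lift t,
        mu t = 2 * size L - k & all (mem L) (t.1.1 ++ t.1.2)].
  elim: k => [|k IHk] lek /=.
    split; rewrite /lift /mu /= ?cats0 //; first by rewrite addn0 subn0.
  have [-> E allL] := IHk (ltnW lek).
  have [|//|-> ->] := step_lift (iter k stack_step (L, [::], [::])).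
    by rewrite E; lia.
    exact/allP.
  split=> //; first by rewrite E subnS.
  exact: stack_step_all.
have [-> E _] := iter_lift _ (leqnn _).
rewrite /stack_sort /lift; move: E; rewrite subnn /mu.
case: (iter _ _ _) => [[i s] o] /=.
by case: i => [|? ?] /=; [case: s => //= ? ?; lia | lia].
Qed.

(** The letter [N] waits until all of [L] has been popped, then stays at the bottom of the stack
    while [R] is sorted above it. *)
Lemma stack_sort_max (L R : seq nat) (N : nat) :
  all (gtn N) L -> all (gtn N) R ->
  stack_sort (L ++ N :: R) = stack_sort L ++ stack_sort R ++ [:: N].
Proof.
move=> /allP LN /allP RN; rewrite /stack_sort.
(* Read from the right: sort [L], push [N], sort [R], pop [N]. *)
have -> : 2 * size (L ++ N :: R) = (2 * size R).+1 + (1 + 2 * size L).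
  by rewrite size_cat /=; lia.
rewrite iterD iterD iter_stack_step_cat //=; last by move=> x /LN /= /ltnW.
rewrite -[X in iter _ _ (X, _, _)](cats0 R) iter_stack_step_cat //=.
by rewrite -cats1 catA.
Qed.

(** Sorting permutes the letters, so a search among the [permutations] of [w] is exhaustive and
    keeps the predicate boolean. *)
Definition ss_image (w : seq nat) : bool :=
  has (fun q => stack_sort q == w) (permutations w).

Lemma ss_imageP w : reflect (exists q, stack_sort q = w) (ss_image w).
Proof.
apply: (iffP hasP) => [[q _ /eqP] | [q]]; first by exists q.
by move=> <-; exists q; rewrite // mem_permutations perm_sym perm_stack_sort.
Qed.

Lemma ss_image_sort (q : seq nat) : ss_image (stack_sort q).
Proof. by apply/ss_imageP; exists q. Qed.

Lemma all_stack_sort a q : all a (stack_sort q) = all a q.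
Proof. exact/perm_all/perm_stack_sort. Qed.

Lemma uniq_stack_sort (q : seq nat) : uniq (stack_sort q) = uniq q.
Proof. exact/perm_uniq/perm_stack_sort. Qed.

Lemma size_stack_sort (q : seq nat) : size (stack_sort q) = size q.
Proof. exact/perm_size/perm_stack_sort. Qed.

Lemma ss_image_cat (A B : seq nat) (N : nat) : ss_image A -> ss_image B ->
  all (gtn N) A -> all (gtn N) B -> ss_image (A ++ B ++ [:: N]).
Proof.
move=> /ss_imageP[L <-] /ss_imageP[R <-]; rewrite !all_stack_sort => LN RN.
by rewrite -stack_sort_max // ss_image_sort.
Qed.

Lemma uniq_max_split (q : seq nat) : q != [::] -> uniq q ->
  exists (L : seq nat) (N : nat) (R : seq nat),
    [/\ q = L ++ N :: R, all (gtn N) L & all (gtn N) R].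
Proof.
move=> q0 uq; have [N Nq maxN] : exists2 N, N \in q & {in q, forall x, x <= N}.
  elim: q q0 {uq} => // x [|y q] IHq _.
    by exists x; rewrite ?mem_head // => z; rewrite inE => /eqP->.
  have [//|N Nq maxN] := IHq; have [lexN|ltNx] := leqP x N.
    by exists N => [|z]; rewrite inE ?Nq ?orbT // => /predU1P[->|/maxN].
  exists x => [|z]; rewrite ?mem_head // inE => /predU1P[->//|/maxN].
  by move=> /leq_trans; apply; apply: ltnW.
case/splitPr: Nq uq maxN => L R; rewrite uniq_catC /= mem_cat negb_or.
move=> /andP[/andP[NR NL] _] maxN; exists L, N, R; split=> //; apply/allP => x xI /=.
  rewrite ltn_neqAle maxN ?mem_cat ?xI // andbT.
  by apply: contraNneq NL => <-.
rewrite ltn_neqAle maxN ?mem_cat ?inE ?xI ?orbT // andbT.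
by apply: contraNneq NR => <-.
Qed.

(** * Descents and good words *)

(** The default [x] of [head] keeps the last letter from counting as a descent. *)
Fixpoint des (w : seq nat) : nat :=
  if w is x :: w' then (head x w' < x) + des w' else 0.

Lemma des_cat (A B : seq nat) (b : nat) :
  des (A ++ b :: B) = des A + (b < last b A) + des (b :: B).
Proof.
elim: A => [|x A IHA]; first by rewrite /= ltnn.
rewrite cat_cons [des (x :: _ ++ _)]/= {}IHA.
by case: A => [|y A] /=; rewrite ?ltnn; lia.
Qed.

Lemma des_rcons_max (v : seq nat) (N : nat) : all (gtn N) v -> des (v ++ [:: N]) = des v.
Proof.
move=> /allP vN; rewrite des_cat /= ltnn !addn0.
case: v vN => [|x v] vN /=; first by rewrite ltnn addn0.
have /= := vN _ (mem_last x v); rewrite ltnNge => /negbTE.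
by rewrite leq_eqVlt => /norP[_ /negbTE->]; rewrite addn0.
Qed.

(** The equality case of the bound [ss_image_des]; the recursive description by blocks is derived in
    [good_cases]. *)
Definition good (w : seq nat) : bool := ss_image w && (size w == (2 * des w).+1).

Lemma good_ss_image (w : seq nat) : good w -> ss_image w.
Proof. by case/andP. Qed.

Lemma good_size (w : seq nat) : good w -> size w = (2 * des w).+1.
Proof. by case/andP=> _ /eqP. Qed.

Lemma good_neq_nil (w : seq nat) : good w -> w <> [::].
Proof. by move=> /good_size + w0; rewrite w0. Qed.

Lemma good1 x : good [:: x].
Proof.
by rewrite /good /= ltnn andbT; apply/ss_imageP; exists [:: x].
Qed.

Lemma ss_image_split (w : seq nat) : uniq w -> w <> [::] -> ss_image w ->
  exists (A B : seq nat) (N : nat), [/\ w = A ++ B ++ [:: N], ss_image A, ss_image B,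
    all (gtn N) A & all (gtn N) B].
Proof.
move=> uw w0 /ss_imageP[q qw]; move: uw w0; rewrite -{}qw => uq q0.
have [||L [N [R [-> LN RN]]]] := @uniq_max_split q.
- by apply/eqP => q00; rewrite q00 in q0.
- by rewrite -uniq_stack_sort.
exists (stack_sort L), (stack_sort R), N.
by rewrite !ss_image_sort !all_stack_sort LN RN stack_sort_max.
Qed.

(** Induction along [w = A B N]. The cases where exactly one block is empty coincide, since the word
    is then the other block followed by [N]. *)
Lemma ss_image_ind (P : seq nat -> Prop) :
  (forall x, P [:: x]) ->
  (forall (B : seq nat) (N : nat), B <> [::] -> uniq B -> all (gtn N) B ->
     ss_image B -> P B -> P (B ++ [:: N])) ->
  (forall (A B : seq nat) (N : nat), A <> [::] -> B <> [::] -> uniq (A ++ B) ->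
     all (gtn N) A -> all (gtn N) B -> ss_image A -> ss_image B ->
     P A -> P B -> P (A ++ B ++ [:: N])) ->
  forall w : seq nat, uniq w -> w <> [::] -> ss_image w -> P w.
Proof.
move=> P1 P2 P3 w; have [n] := ubnP (size w).
elim: n w => // n IHn w le_w_n uw w0 sw.
have [A [B [N [Ew sA sB AN BN]]]] := ss_image_split uw w0 sw.
move: le_w_n uw; rewrite Ew !size_cat /= addn1 addnS ltnS => le_w_n.
rewrite catA cats1 rcons_uniq cat_uniq => /andP[_ uAB].
have /and3P[uA _ uB] := uAB; rewrite -cats1 -catA.
case: (eqVneq A [::]) => [A0|/eqP A0]; case: (eqVneq B [::]) => [B0|/eqP B0].
- by rewrite A0 B0; apply: P1.
- by rewrite A0; apply: P2 => //; apply: IHn => //; lia.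
- by rewrite B0; apply: P2 => //; apply: IHn => //; lia.
by apply: P3; rewrite // ?cat_uniq //; apply: IHn => //;
  move: A0 B0; case: (A) le_w_n => //= ? ?; case: (B) => //= ? ?; lia.
Qed.

Lemma ss_image_last (w : seq nat) : uniq w -> w <> [::] -> ss_image w ->
  {in w, forall x, x <= last 0 w}.
Proof.
move=> uw w0 sw; have [A [B [N [-> _ _ AN BN]]]] := ss_image_split uw w0 sw.
move=> x; rewrite !last_cat /= !mem_cat inE => /or3P[| |/eqP->//].
- by move=> /(allP AN)/ltnW.
- by move=> /(allP BN)/ltnW.
Qed.

(** Only the junction of [A] and [B] can add a descent in [A B N], and [(2a + 1) + (2b + 1) + 1 =
    2(a + b + 1) + 1]. *)
Lemma ss_image_des (w : seq nat) : uniq w -> w <> [::] -> ss_image w ->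
  (2 * des w).+1 <= size w.
Proof.
move: w; apply: ss_image_ind => [x|B N _ _ BN _ IH|A B N _ B0 _ AN BN _ _ IHA IHB].
- by rewrite /= ltnn.
- by rewrite des_rcons_max // size_cat /=; lia.
rewrite catA des_rcons_max ?all_cat ?AN // !size_cat /=.
case: B B0 IHB {BN} => // b B _ IHB; rewrite des_cat.
by case: (b < _); lia.
Qed.

(* In terms of decreasing trees: hang the tree of [A] below the leftmost leaf
   of the tree of [B]. *)
Lemma ss_image_cat_asc (A B : seq nat) : uniq A -> A <> [::] -> ss_image A ->
  uniq B -> B <> [::] -> ss_image B -> last 0 A < head 0 B ->
  ss_image (A ++ B).
Proof.
move=> uA A0 sA; have maxA := ss_image_last uA A0 sA.
move: B; apply: ss_image_ind
  => [x|B N B0 uB BN sB IHB|C B N C0 B0 _ CN BN sC sB IHC _] /= lt.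
- apply: (@ss_image_cat A [::] x) => //.
  by apply/allP => y /maxA yA /=; apply: leq_ltn_trans yA lt.
- have E : head 0 (B ++ [:: N]) = head 0 B by case: (B) B0.
  rewrite E in lt; rewrite catA; apply: (@ss_image_cat (A ++ B) [::] N) => //.
    exact: IHB.
  rewrite all_cat BN andbT; apply/allP => y /maxA yA /=.
  apply: leq_ltn_trans yA (ltn_trans lt _).
  by case: (B) BN B0 => //= ? ? /andP[].
have E : head 0 (C ++ B ++ [:: N]) = head 0 C by case: (C) C0.
rewrite E in lt; rewrite catA; apply: ss_image_cat => //; first exact: IHC.
rewrite all_cat CN andbT; apply/allP => y /maxA yA /=.
apply: leq_ltn_trans yA (ltn_trans lt _).
by case: (C) CN C0 => //= ? ? /andP[].
Qed.

Lemma good_cat (A B : seq nat) (N : nat) : good A -> good B -> head 0 B < last 0 A ->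
  all (gtn N) A -> all (gtn N) B -> good (A ++ B ++ [:: N]).
Proof.
move=> /andP[sA /eqP zA] /andP[sB /eqP zB] lt AN BN.
rewrite /good ss_image_cat //= catA des_rcons_max ?all_cat ?AN //.
rewrite !size_cat zA zB /=.
case: B lt zB {BN sB} => [|b B] lt zB //; rewrite des_cat.
have -> : last b A = last 0 A by case: (A) zA.
by rewrite /= in lt; rewrite lt; lia.
Qed.

(** Equality for the whole word forces equality in both blocks and a descent at the junction. If
    exactly one block is empty, the other would violate [ss_image_des] by one. *)
Lemma good_split (A B : seq nat) (N : nat) : uniq (A ++ B) -> ss_image A -> ss_image B ->
  all (gtn N) A -> all (gtn N) B -> good (A ++ B ++ [:: N]) ->
  (A = [::] /\ B = [::]) \/ [/\ good A, good B & head 0 B < last 0 A].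
Proof.
rewrite cat_uniq => /and3P[uA _ uB] sA sB AN BN /good_size.
rewrite catA des_rcons_max ?all_cat ?AN // !size_cat /= => zAB.
have [A0|/eqP A0] := eqVneq A [::]; have [B0|/eqP B0] := eqVneq B [::].
- by left.
- by have := ss_image_des uB B0 sB; rewrite A0 /= in zAB; lia.
- by have := ss_image_des uA A0 sA; rewrite B0 cats0 /= in zAB; lia.
right; have := ss_image_des uA A0 sA; have := ss_image_des uB B0 sB.
case: B B0 sB zAB {uB BN} => // b B _ sB; rewrite des_cat.
have -> : last b A = last 0 A by case: (A) A0.
rewrite /good sA sB => zAB leB leA; rewrite [head 0 _]/=.
have lt : b < last 0 A by case: ltnP zAB => // _; lia.
by rewrite lt in zAB; split=> //=; apply/eqP; move: zAB leA leB => /=; lia.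
Qed.

Lemma good_cases (w : seq nat) : uniq w -> good w ->
  (exists x, w = [:: x]) \/
  exists (A B : seq nat) (N : nat),
    [/\ w = A ++ B ++ [:: N], good A, good B, head 0 B < last 0 A
    & all (gtn N) A && all (gtn N) B].
Proof.
move=> uw gw.
have [A [B [N [Ew sA sB AN BN]]]] :=
  ss_image_split uw (good_neq_nil gw) (good_ss_image gw).
have uAB : uniq (A ++ B).
  by move: uw; rewrite Ew catA cats1 rcons_uniq => /andP[].
rewrite Ew in gw; have [[A0 B0]|[gA gB lt]] := good_split uAB sA sB AN BN gw.
  by left; exists N; rewrite Ew A0 B0.
by right; exists A, B, N; rewrite AN BN.
Qed.

(** The inequality opposite to [ss_image_des], needed for the uniqueness of the decomposition. A
    proper prefix of [A B N] lies inside [A], or is [A] followed by a prefix of [B]; in the second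
    case the descent at the junction makes up for the sum of the two bounds. *)
Lemma good_prefix (C D : seq nat) : uniq (C ++ D) -> good (C ++ D) -> C <> [::] ->
  size C <= (2 * des C).+1.
Proof.
have [n] := ubnP (size (C ++ D)); elim: n C D => // n IHn C D le_n u g C0.
have [D0|/eqP D0] := eqVneq D [::].
  by rewrite D0 cats0 in g; rewrite (good_size g).
have [[x]|[A [B [N [E gA gB lt /andP[AN BN]]]]]] := good_cases u g.
  by case: C C0 {le_n u g} => // c [|? ?] _; case: D D0.
move: u; rewrite E catA cat_uniq => /andP[uAB _].
have := uAB; rewrite cat_uniq => /and3P[uA _ uB].
have leAB : size A + size B < n.
  by move: le_n; rewrite E !size_cat /=; lia.
have [leCA|ltAC] := leqP (size C) (size A).
  have EA : A = C ++ drop (size C) A.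
    have := congr1 (take (size C)) E; rewrite take_size_cat // takel_cat //.
    by move=> ->; rewrite size_take_min (minn_idPl _) ?cat_take_drop.
  by apply: (IHn C (drop (size C) A)); rewrite -?EA //; lia.
have [C' EC] : exists C', C = A ++ C'.
  exists (drop (size A) C).
  have := congr1 (take (size A)) E; rewrite takel_cat ?(ltnW ltAC) //.
  by rewrite take_size_cat // => EA; rewrite -{1}EA cat_take_drop.
move: E ltAC C0; rewrite EC -catA => /eqP; rewrite eqseq_cat // eqxx /= => /eqP E.
rewrite size_cat; case: C' E EC => [|c C'] E EC; first by rewrite addn0 ltnn.
move=> _ _; rewrite des_cat.
(* The letter [c] is also the first letter of [B], so the junction is the descent [lt]. *)
have cB : c < last c A.
  have -> : last c A = last 0 A by case: (A) (good_neq_nil gA).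
  by apply: leq_ltn_trans lt; case: (B) (good_neq_nil gB) E => //= ? ? _ [->].
rewrite cB (good_size gA).
have EB : B = (c :: C') ++ drop (size (c :: C')) B.
  have := congr1 (take (size (c :: C'))) E; rewrite take_size_cat // takel_cat.
    by move=> EB; rewrite {1}EB cat_take_drop.
  have := congr1 size E; rewrite !size_cat /= addn1.
  by case: D D0 {g E le_n} => //= ? ? _; lia.
have : size (c :: C') <= (2 * des (c :: C')).+1.
  by apply: (IHn _ (drop (size (c :: C')) B)); rewrite -?EB //; lia.
by lia.
Qed.

(** If the cuts differ, then up to symmetry [A' = A C] with [C] a nonempty prefix of the good word
    [B]. The junction of [A] and [C] is a descent, so [good_prefix] gives [size A' <= 2 * des A'],
    and [A'] is not good. *)
Lemma good_cat_inj (A B A' B' : seq nat) : uniq (A ++ B) ->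
  good A -> good B -> head 0 B < last 0 A ->
  good A' -> good B' -> head 0 B' < last 0 A' ->
  A ++ B = A' ++ B' -> A = A' /\ B = B'.
Proof.
wlog leAA' : A B A' B' / size A <= size A'.
  move=> WL uAB gA gB lt gA' gB' lt' E; case: (leqP (size A) (size A')) => [le|/ltnW le].
    exact: WL E.
  by have [] := WL _ _ _ _ le _ gA' gB' lt' gA gB lt (esym E); rewrite -?E.
move=> uAB gA gB lt gA' gB' lt' E.
have EA' : A' = A ++ drop (size A) A'.
  have := congr1 (take (size A)) E; rewrite take_size_cat // takel_cat //.
  by move=> EA; rewrite {1}EA cat_take_drop.
move: EA' E; set C := drop _ _ => EA'; rewrite EA' -catA => /eqP.
rewrite eqseq_cat // eqxx /= => /eqP EB.
case: (eqVneq C [::]) => [C0|/eqP C0]; first by rewrite C0 cats0 in EB *.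
have : size C <= (2 * des C).+1.
  apply: (@good_prefix C B') => //; rewrite -EB //.
  by move: uAB; rewrite cat_uniq => /and3P[].
have := good_size gA'; have := good_size gA; rewrite EA' size_cat.
case: C C0 EB {EA'} => // c C _ EB; rewrite des_cat.
have -> : last c A = last 0 A by case: (A) (good_neq_nil gA).
by move: lt; rewrite EB /= => ->; lia.
Qed.

(** * Uniquely sorted permutations *)

(** Both preimages have the form [L N R] with the same [N], the last letter of [w]. By
    [good_cat_inj] the images of their left parts agree, as do those of their right parts, and
    induction applies to each. *)
Lemma good_preimage_inj (w q q' : seq nat) : uniq w -> good w ->
  stack_sort q = w -> stack_sort q' = w -> q = q'.
Proof.
have [n] := ubnP (size w); elim: n w q q' => // n IHn w q q' le_w_n uw gw qw q'w.
have split_q p : stack_sort p = w -> exists (L : seq nat) (N : nat) (R : seq nat),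
    [/\ p = L ++ N :: R, all (gtn N) L & all (gtn N) R].
  move=> pw; apply: uniq_max_split; last by rewrite -uniq_stack_sort pw.
  by apply/eqP => p0; move: gw; rewrite -pw p0 => /good_neq_nil.
have [L [N [R [Eq LN RN]]]] := split_q q qw.
have [L' [N' [R' [Eq' LN' RN']]]] := split_q q' q'w.
have Ew : w = stack_sort L ++ stack_sort R ++ [:: N] by rewrite -qw Eq stack_sort_max.
have Ew' : w = stack_sort L' ++ stack_sort R' ++ [:: N'].
  by rewrite -q'w Eq' stack_sort_max.
have /eqP := Ew'; rewrite {1}Ew !catA !cats1 eqseq_rcons => /andP[/eqP EE /eqP EN].
rewrite -{N'}EN in Eq' LN' RN' Ew'.
have uLR : uniq (stack_sort L ++ stack_sort R).
  by move: uw; rewrite Ew catA cats1 rcons_uniq => /andP[].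
have leLR : size (stack_sort L) + size (stack_sort R) < n.
  by move: le_w_n; rewrite Ew !size_cat /=; lia.
have := gw; rewrite Ew => /good_split[] //; rewrite ?ss_image_sort ?all_stack_sort //.
  case=> L0 R0; move: EE; rewrite L0 R0 => /esym/eqP.
  rewrite -size_eq0 size_cat addn_eq0 !size_stack_sort !size_eq0.
  case/andP=> /eqP L'0 /eqP R'0; rewrite Eq Eq' L'0 R'0.
  have /eqP := congr1 size L0; rewrite size_stack_sort size_eq0 => /eqP->.
  by have /eqP := congr1 size R0; rewrite size_stack_sort size_eq0 => /eqP->.
case=> gL gR lt.
have := gw; rewrite Ew' => /good_split[];
  rewrite -?EE ?ss_image_sort ?all_stack_sort //.
  case=> L'0 R'0; move: EE; rewrite L'0 R'0 => /eqP.
  rewrite -size_eq0 size_cat addn_eq0 !size_eq0.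
  by case/andP=> /eqP /(good_neq_nil gL).
case=> gL' gR' lt'.
have [EL ER] := good_cat_inj uLR gL gR lt gL' gR' lt' EE.
move: uLR; rewrite cat_uniq => /and3P[uL _ uR].
rewrite Eq Eq'; congr (_ ++ _ :: _).
  by apply: (IHn (stack_sort L)) => //; lia.
by apply: (IHn (stack_sort R)) => //; lia.
Qed.

Lemma eq_cat_max (N : nat) (L R L' R' : seq nat) :
  all (gtn N) L -> all (gtn N) L' -> L ++ N :: R = L' ++ N :: R' ->
  L = L' /\ R = R'.
Proof.
elim: L L' => [|x L IHL] [|x' L'] //=.
- by move=> _ _ [].
- by move=> _ /andP[/= lt _] [E]; rewrite E ltnn in lt.
- by move=> /andP[/= lt _] _ [E]; rewrite E ltnn in lt.
by move=> /andP[_ LN] /andP[_ L'N] [-> /IHL[] // -> ->].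
Qed.

(** Each failure of goodness yields a second preimage. If just one of [L], [R] is empty, [N] can
    move to the other end. If neither is, the preimages of the two blocks can be changed
    independently, so both blocks are good by induction. If the junction is an ascent, the
    concatenated blocks have a preimage [Q] by [ss_image_cat_asc], and [Q N] has the same image as
    [q]. *)
Lemma unique_preimage_good (q : seq nat) : uniq q -> q <> [::] ->
  (forall q', stack_sort q' = stack_sort q -> q' = q) -> good (stack_sort q).
Proof.
have [n] := ubnP (size q); elim: n q => // n IHn q le_q_n uq q0 inj.
have [|//|L [N [R [Eq LN RN]]]] := @uniq_max_split q; first exact/eqP.
have leLR : size L + size R < n by move: le_q_n; rewrite Eq size_cat /=; lia.
have [L0|/eqP L0] := eqVneq L [::].
  have [R0|/eqP R0] := eqVneq R [::]; first by rewrite Eq L0 R0 good1.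
  have : R ++ [:: N] = q.
    by apply: inj; rewrite Eq L0 !stack_sort_max //= cats0.
  rewrite Eq L0 -[RHS]/([::] ++ N :: R) => /eq_cat_max[] //.
have [R0|/eqP R0] := eqVneq R [::].
  have : N :: L = q.
    by apply: inj; rewrite Eq R0 -[_ :: L]/([::] ++ N :: L) !stack_sort_max.
  rewrite Eq R0 -[LHS]/([::] ++ N :: L) => /eq_cat_max[] //.
have uLR : uniq (L ++ R).
  apply: subseq_uniq uq; rewrite Eq; exact: cat_subseq (subseq_refl _) (subseq_cons _ _).
have := uLR; rewrite cat_uniq => /and3P[uL /hasPn dLR uR].
have gL : good (stack_sort L).
  apply: IHn => // [|L' EL']; first by lia.
  have L'N : all (gtn N) L' by rewrite -all_stack_sort EL' all_stack_sort.
  have : L' ++ N :: R = q by apply: inj; rewrite Eq !stack_sort_max // EL'.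
  by rewrite Eq => /eq_cat_max[].
have gR : good (stack_sort R).
  apply: IHn => // [|R' ER']; first by lia.
  have R'N : all (gtn N) R' by rewrite -all_stack_sort ER' all_stack_sort.
  have : L ++ N :: R' = q by apply: inj; rewrite Eq !stack_sort_max // ER'.
  by rewrite Eq => /eq_cat_max[].
rewrite Eq stack_sort_max //; apply: good_cat; rewrite ?all_stack_sort //.
case: ltngtP => // [lt|E].
  have /ss_imageP[Q EQ] : ss_image (stack_sort L ++ stack_sort R).
    apply: ss_image_cat_asc; rewrite ?uniq_stack_sort ?ss_image_sort //;
      exact: good_neq_nil.
  have QN : all (gtn N) Q by rewrite -all_stack_sort EQ all_cat !all_stack_sort LN.
  have : Q ++ [:: N] = q.
    by apply: inj; rewrite Eq !stack_sort_max //= EQ catA.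
  rewrite Eq => /eq_cat_max[] // _ E; by case: R0.
have lL : last 0 (stack_sort L) \in L.
  rewrite -(perm_mem (perm_stack_sort L)).
  by case: (stack_sort L) (good_neq_nil gL) => // x s _; apply: mem_last.
have hR : head 0 (stack_sort R) \in R.
  rewrite -(perm_mem (perm_stack_sort R)).
  by case: (stack_sort R) (good_neq_nil gR) => // x s _; apply: mem_head.
by have := dLR _ hR; rewrite E lL.
Qed.

(** * Permutations as words on a set of letters *)

Definition letters (n : nat) (X : {set 'I_n}) : seq nat :=
  [seq (nat_of_ord i).+1 | i <- enum X].

Lemma succ_ord_inj n : injective (fun i : 'I_n => (nat_of_ord i).+1).
Proof. by move=> i j [] /val_inj. Qed.

Lemma uniq_letters n (X : {set 'I_n}) : uniq (letters X).
Proof. by rewrite map_inj_uniq ?enum_uniq //; apply: succ_ord_inj. Qed.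

Lemma mem_letters n (X : {set 'I_n}) i : ((nat_of_ord i).+1 \in letters X) = (i \in X).
Proof. by rewrite (mem_map (@succ_ord_inj n)) mem_enum. Qed.

Lemma size_letters n (X : {set 'I_n}) : size (letters X) = #|X|.
Proof. by rewrite size_map cardE. Qed.

Lemma word_inj n : injective (@word n).
Proof.
move=> p q /eq_in_map E; apply/permP => i.
by have [] := E i (mem_enum _ i); apply: val_inj.
Qed.

Lemma perm_word n (p : 'S_n) : perm_eq (word p) (letters [set: 'I_n]).
Proof.
rewrite /word /letters (map_comp (fun i : 'I_n => (nat_of_ord i).+1) p).
apply: perm_map; apply: uniq_perm; rewrite ?enum_uniq //.
  by rewrite map_inj_uniq ?enum_uniq //; apply: perm_inj.
move=> i; rewrite mem_enum inE; apply/mapP; exists (p^-1%g i).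
  by rewrite mem_enum.
by rewrite permKV.
Qed.

(** An inclusion between duplicate-free lists that both have [n!] entries. *)
Lemma perm_words n :
  perm_eq [seq word p | p <- enum 'S_n] (permutations (letters [set: 'I_n])).
Proof.
have uW : uniq [seq word p | p <- enum 'S_n].
  by rewrite map_inj_uniq ?enum_uniq //; apply: word_inj.
apply: uniq_perm; rewrite ?permutations_uniq //.
apply: (uniq_min_size uW _ _).2 => [w /mapP[p _ ->]|].
  by rewrite mem_permutations perm_word.
rewrite size_permutations ?uniq_letters // size_letters cardsT card_ord.
by rewrite size_map -cardE card_Sn.
Qed.

Lemma word_surj n (w : seq nat) :
  perm_eq w (letters [set: 'I_n]) -> exists p : 'S_n, word p = w.
Proof.
rewrite -mem_permutations -(perm_mem (perm_words n)) => /mapP[p _ ->].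
by exists p.
Qed.

Lemma uniq_word n (p : 'S_n) : uniq (word p).
Proof. by rewrite (perm_uniq (perm_word p)) uniq_letters. Qed.

(** The case [n = 0] is excluded because the empty word has one preimage but is not good. *)
Lemma uniquely_sortedE n (p : 'S_n) : 0 < n -> uniquely_sorted p = good (word p).
Proof.
move=> n0; rewrite /uniquely_sorted /fertility.
(* A preimage among all words is already the word of a permutation, so the two notions of uniqueness
   agree. *)
have pre (q : seq nat) : stack_sort q = word p -> exists q' : 'S_n, word q' = q.
  move=> qp; apply: word_surj; apply: perm_trans (perm_word p).
  by rewrite -qp perm_sym perm_stack_sort.
apply/cards1P/idP => [[q Eq]|gp].
  have qp : stack_sort (word q) = word p.
    by have := set11 q; rewrite -Eq inE => /eqP.
  rewrite -qp; apply: unique_preimage_good; first exact: uniq_word.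
    by move=> /(congr1 size); rewrite size_map -cardE card_ord => E; rewrite E in n0.
  move=> w; rewrite qp => wp; have [q' Eq'] := pre w wp.
  have : q' \in [set q] by rewrite -Eq inE Eq' wp.
  by rewrite inE => /eqP <-.
have /ss_imageP[w wp] := good_ss_image gp; have [q Eq] := pre w wp.
exists q; apply/setP => q'; rewrite !inE; apply/eqP/eqP => [q'p|->]; last by rewrite Eq.
by apply: word_inj; rewrite Eq; apply: (good_preimage_inj (uniq_word p)).
Qed.

Definition good_words (n : nat) (X : {set 'I_n}) : seq (seq nat) :=
  [seq w <- permutations (letters X) | good w].

Lemma card_uniquely_sorted n : 0 < n ->
  #|[set p : 'S_n | uniquely_sorted p]| = size (good_words [set: 'I_n]).
Proof.
move=> n0; rewrite size_filter -(seq.permP (perm_words n)) count_map.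
rewrite cardsE cardE size_filter -enumT; apply: eq_count => p /=.
by rewrite -uniquely_sortedE.
Qed.

(** * Catalan numbers *)

Lemma catalan_rec n : n.+2 * catalan n.+1 = (4 * n + 2) * catalan n.
Proof.
have E0 := catalanE n; have E1 := catalanE n.+1.
have := mul_bin_diag (2 * n).+2 n; have := mul_bin_down (2 * n).+1 n.
have E2 : 2 * n.+1 = (2 * n).+2 by lia.
rewrite E2 in E1; rewrite /= -E0 -E1.
have -> : (2 * n).+1 - n = n.+1 by lia.
set c := 'C(_, _) => D1 D2; apply/eqP; rewrite -(eqn_pmul2l (ltn0Sn n)); apply/eqP.
by nia.
Qed.

(** With [S] the convolution and [T] its version weighted by [i], the symmetry of [i] and [n - i]
    gives [2 T = n S], and [catalan_rec] applied termwise gives [E]. Eliminating [T] leaves the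
    recurrence [catalan_rec] for [S]. *)
Lemma catalan_conv n : \sum_(i < n.+1) catalan i * catalan (n - i) = catalan n.+1.
Proof.
pose S n := \sum_(i < n.+1) catalan i * catalan (n - i).
pose T n := \sum_(i < n.+1) i * (catalan i * catalan (n - i)).
have TS k : 2 * T k = k * S k.
  have Trev : T k = \sum_(i < k.+1) (k - i) * (catalan i * catalan (k - i)).
    rewrite /T (reindex_inj rev_ord_inj) /=; apply: eq_bigr => i _.
    by rewrite subSS subKn ?leq_ord // (mulnC (catalan _)).
  rewrite mul2n -addnn {2}Trev /T -big_split /S big_distrr /=.
  by apply: eq_bigr => i _; rewrite -mulnDl subnKC ?leq_ord.
rewrite -/(S n); elim: n => [|n IHn]; first by rewrite /S big_ord_recl big_ord0.
(* The weight is now [i + 1]. The term [i = 0] is split off; in the others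
   [(i + 2) C_(i+1) = (4 i + 2) C_i] after the index shift. *)
have E : T n.+1 + S n.+1 = catalan n.+1 + 4 * T n + 2 * S n.
  rewrite /T /S -big_split /= big_ord_recl /= mul0n add0n subn0 mul1n -addnA.
  congr (_ + _); rewrite !big_distrr -big_split /=; apply: eq_bigr => i _.
  by rewrite /bump /= add1n subSS mulnA; have := catalan_rec i; nia.
have := TS n.+1; have := TS n; have := catalan_rec n.+1; nia.
Qed.

Local Open Scope ring_scope.

(* The moments of the semicircle law of variance -1. *)
Definition moment (n : nat) : int :=
  if odd n then 0 else (-1) ^+ n./2 * (catalan n./2)%:Z.

Lemma moment_odd n : odd n -> moment n = 0.
Proof. by rewrite /moment => ->. Qed.

Lemma moment_double k : moment k.*2 = (-1) ^+ k * (catalan k)%:Z.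
Proof. by rewrite /moment odd_double doubleK. Qed.

Lemma sum_even_index (F : nat -> int) k : (forall i, odd i -> F i = 0) ->
  \sum_(i < k.*2.+1) F i = \sum_(j < k.+1) F j.*2.
Proof.
move=> F0; elim: k => [|k IHk]; first by rewrite !big_ord_recl !big_ord0.
rewrite doubleS 2!big_ord_recr [RHS]big_ord_recr /= IHk F0 ?addr0 //.
by rewrite /= odd_double.
Qed.

(** For even [n] the two indices have opposite parities and every product vanishes; for odd [n] only
    even indices survive, leaving Catalan's recurrence up to sign. *)
Lemma moment_rec n : moment n.+1 = - \sum_(i < n) moment i * moment (n.-1 - i).
Proof.
have [on|en] := boolP (odd n); last first.
  rewrite moment_odd // big1 ?oppr0 // => i _.
  case: (boolP (odd i)) => oi; first by rewrite moment_odd ?mul0r.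
  rewrite [X in _ * X]moment_odd ?mulr0 //.
  by have := ltn_ord i; lia.
have -> : n = n./2.*2.+1 by lia.
set k := n./2; rewrite -doubleS moment_double /=.
rewrite (sum_even_index (F := fun i => moment i * moment (k.*2 - i))); last first.
  by move=> i oi; rewrite moment_odd ?mul0r.
rewrite -catalan_conv (big_morph Posz PoszD (erefl _)) mulr_sumr -sumrN.
apply: eq_bigr => i _; rewrite -doubleB !moment_double PoszM exprS.
have -> : (-1) ^+ k = (-1) ^+ i * (-1) ^+ (k - i) :> int.
  by rewrite -exprD subnKC ?leq_ord.
by ring.
Qed.

(** * The convolution identity *)

Lemma big_subset_setU1 (T : finType) (F : {set T} -> int) N (Y : {set T}) :
  N \notin Y ->
  \sum_(L : {set T} | L \subset N |: Y) F L =
  \sum_(L : {set T} | L \subset Y) F L + \sum_(L : {set T} | L \subset Y) F (N |: L).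
Proof.
move=> NY; rewrite (bigID (fun L : {set T} => N \in L)) /= addrC; congr (_ + _).
  by apply: eq_bigl => L; rewrite -subsetD1 setU1K.
rewrite (reindex_onto (fun L => N |: L) (fun L => L :\ N)) /=; last first.
  by move=> L /andP[_ NL]; rewrite setD1K.
apply: eq_bigl => L; rewrite setU11 andbT.
have [NL|NL] := boolP (N \in L).
  have -> : (L \subset Y) = false by apply/negbTE/subsetPn; exists N.
  have -> : (((N |: L) :\ N) == L) = false; last by rewrite andbF.
  by apply/negbTE; apply: contraTneq NL => <-; rewrite !inE eqxx.
rewrite setU1K // eqxx andbT; apply/idP/idP => [|/setUS->//].
by rewrite -{2}(setU1K NY) subsetD1 NL andbT subUset => /andP[].
Qed.

(** Chains of subsets [A], [L] of [Y] are reparametrised by [A] and [R = L :\: A]. *)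
Lemma big_subset_subset (T : finType) (F : {set T} -> {set T} -> int) (Y : {set T}) :
  \sum_(L : {set T} | L \subset Y) \sum_(A : {set T} | A \subset L) F A L =
  \sum_(A : {set T} | A \subset Y) \sum_(R : {set T} | R \subset Y :\: A) F A (A :|: R).
Proof.
rewrite (exchange_big_dep (fun A : {set T} => A \subset Y)) /=; last first.
  by move=> L A LY AL; apply: subset_trans AL LY.
apply: eq_bigr => A AY.
rewrite (reindex_onto (fun R => A :|: R) (fun L => L :\: A)) /=; last first.
  move=> L /andP[_ AL]; apply/setP => y; rewrite !inE.
  by case: (boolP (y \in A)) => //= /(subsetP AL) ->.
apply: eq_bigl => R; rewrite subUset AY subsetUl andbT /= setDUl setDv set0U.
by rewrite subsetD; congr (_ && _); apply/eqP/setDidPl.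
Qed.

Definition below n (X : {set 'I_n}) (r : 'I_n) : {set 'I_n} := [set y in X | (y < r)%N].
Definition above n (X : {set 'I_n}) (r : 'I_n) : {set 'I_n} := [set y in X | (r < y)%N].

Lemma set_max_split n (X : {set 'I_n}) : X != set0 ->
  exists N (Y : {set 'I_n}), X = N |: Y /\ {in Y, forall y : 'I_n, (y < N)%N}.
Proof.
case/set0Pn=> x xX; case: (arg_maxnP (fun i : 'I_n => i : nat) xX) => N NX maxN.
exists N, (X :\ N); rewrite setD1K //; split=> // y /setD1P[yN yX].
by rewrite ltn_neqAle yN; apply: maxN.
Qed.

Lemma max_notin n (N : 'I_n) (Y : {set 'I_n}) :
  {in Y, forall y : 'I_n, (y < N)%N} -> N \notin Y.
Proof. by move=> YN; apply/negP => /YN; rewrite ltnn. Qed.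

Lemma below_max n (N : 'I_n) (Y : {set 'I_n}) :
  {in Y, forall y : 'I_n, (y < N)%N} -> below (N |: Y) N = Y.
Proof.
move=> YN; apply/setP => y; rewrite !inE; case: eqVneq => [->|_] /=.
  by rewrite ltnn (negbTE (max_notin YN)).
by case: (boolP (y \in Y)) => // /YN ->.
Qed.

Lemma above_max n (N : 'I_n) (Y : {set 'I_n}) :
  {in Y, forall y : 'I_n, (y < N)%N} -> above (N |: Y) N = set0.
Proof.
move=> YN; apply/setP => y; rewrite !inE; case: eqVneq => [->|_] /=.
  by rewrite ltnn.
by case: (boolP (y \in Y)) => // /YN yN; rewrite ltnNge (ltnW yN).
Qed.

Lemma below_setU1_max n (N r : 'I_n) (Y : {set 'I_n}) :
  (r < N)%N -> below (N |: Y) r = below Y r.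
Proof.
move=> rN; apply/setP => y; rewrite !inE; case: eqVneq => [->|_] //=.
by rewrite ltnNge (ltnW rN) andbF.
Qed.

Lemma above_setU1_max n (N r : 'I_n) (Y : {set 'I_n}) :
  (r < N)%N -> above (N |: Y) r = N |: above Y r.
Proof. by move=> rN; apply/setP => y; rewrite !inE; case: eqVneq => [->|_]. Qed.

(** Induction by removal of the largest letter: it supplies the last term of the sum and puts one
    more letter above each of the others. *)
Lemma sum_rank n (F : nat -> nat -> int) (Y : {set 'I_n}) :
  \sum_(r in Y) F #|below Y r| #|above Y r| = \sum_(i < #|Y|) F i (#|Y|.-1 - i)%N.
Proof.
have [m] := ubnP #|Y|; elim: m Y F => // m IHm Y F ltYm.
have [->|/set_max_split[N [Z [EY ZN]]]] := eqVneq Y set0.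
  by rewrite big_set0 cards0 big_ord0.
move: ltYm; rewrite {Y}EY cardsU1 (max_notin ZN) big_setU1 ?max_notin //=.
rewrite below_max // above_max // cards0 add1n ltnS => ltZm.
rewrite big_ord_recr /= subnn addrC; congr (_ + _).
transitivity (\sum_(r in Z) F #|below Z r| #|above Z r|.+1).
  apply: eq_bigr => r /ZN rN; rewrite below_setU1_max // above_setU1_max //.
  by rewrite cardsU1 !inE (negbTE (max_notin ZN)).
rewrite (IHm Z (fun a b => F a b.+1)) //; apply: eq_bigr => i _; congr (F _ _).
by case: #|Z| i => [[]|k] i //=; rewrite subSn ?leq_ord.
Qed.

Lemma sum_moment_rank n (Y : {set 'I_n}) :
  \sum_(r in Y) moment #|below Y r| * moment #|above Y r| = - moment #|Y|.+1.
Proof. by rewrite (sum_rank (fun a b => moment a * moment b)) moment_rec opprK. Qed.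

(** The hypotheses on [u] are those satisfied by the number of good words on [X] with first letter
    [x]. For [r] outside [A], the condition [~~ (A \subset below setT r)] says that the largest
    letter of [A] exceeds [r], i.e. that a left block on [A] descends to a right block starting with
    [r]. With [N] the largest letter, the sets [L] without [N] give a negative sum over pairs
    [(A, r)] by the Catalan recurrence, and those with [N] give the same terms, positive, for the
    descending pairs only. What survives has [A] below [r], where induction applies. *)
Lemma moment_convolution n (u : {set 'I_n} -> 'I_n -> int) :
  (forall (X : {set 'I_n}) x, x \notin X -> u X x = 0) ->
  (forall (N : 'I_n) (Y : {set 'I_n}), {in Y, forall y : 'I_n, (y < N)%N} ->
     u (N |: Y) N = (Y == set0)%:R) ->
  (forall (N : 'I_n) (Y : {set 'I_n}) x, {in Y, forall y : 'I_n, (y < N)%N} -> x != N ->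
     u (N |: Y) x = \sum_(A : {set 'I_n} | A \subset Y) \sum_(r in Y :\: A)
       (~~ (A \subset below setT r))%:R * (u A x * u (Y :\: A) r)) ->
  forall (X : {set 'I_n}) x, x \in X ->
  \sum_(L : {set 'I_n} | L \subset X) moment #|X :\: L| * u L x =
    moment #|below X x| * moment #|above X x|.
Proof.
move=> u0 u1 urec X; have [m] := ubnP #|X|; elim: m X => // m IHm X ltXm x xX.
have /set_max_split[N [Y [EX YN]]] : X != set0 by apply/set0Pn; exists x.
have NY := max_notin YN; move: ltXm xX; rewrite {X}EX cardsU1 NY add1n ltnS => ltYm xX.
(* For [x = N], only the singleton of [N] contributes. *)
have [xN|xN] := eqVneq x N.
  rewrite xN below_max // above_max // cards0 mulr1 big_subset_setU1 //.
  rewrite big1 ?add0r => [|L LY]; last first.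
    by rewrite u0 ?mulr0 //; apply: contra NY; apply: (subsetP LY).
  rewrite (bigD1 set0) ?sub0set //= big1 ?addr0 => [|L /andP[LY L0]].
    rewrite u1 ?eqxx ?mulr1 => [|y]; last by rewrite inE.
    by rewrite setU0 setU1K.
  by rewrite u1 ?(negbTE L0) ?mulr0 // => y yL; apply: YN; apply: (subsetP LY).
have xY : x \in Y by move: xX; rewrite !inE (negbTE xN).
have xltN := YN x xY.
have subN (L : {set 'I_n}) : L \subset Y -> N \notin L.
  by move=> LY; apply: contra NY; apply: (subsetP LY).
have ltD (A : {set 'I_n}) : (#|Y :\: A| < m)%N.
  by apply: leq_ltn_trans ltYm; apply: subset_leq_card; apply: subsetDl.
rewrite big_subset_setU1 //.
pose c (A : {set 'I_n}) r := moment #|below (Y :\: A) r| * moment #|above (Y :\: A) r|.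
(* Here [N] lies in the complement of [L], so the index of the moment is a successor and
   [sum_moment_rank] expands it. *)
have -> : \sum_(L : {set 'I_n} | L \subset Y) moment #|(N |: Y) :\: L| * u L x =
    \sum_(A : {set 'I_n} | A \subset Y) \sum_(r in Y :\: A) - (u A x * c A r).
  apply: eq_bigr => L LY.
  have -> : (N |: Y) :\: L = N |: (Y :\: L).
    by rewrite setDUl (setDidPl _) // disjoints1 subN.
  rewrite cardsU1 inE (negbTE NY) andbF add1n.
  rewrite -[moment _]opprK -sum_moment_rank mulNr mulrC mulr_sumr -sumrN.
  by apply: eq_bigr.
(* Here [urec] splits the letters of [L] into [A] and [R]; the sum over [R] is the induction
   hypothesis for [Y :\: A] and the first letter [r]. *)
have -> : \sum_(L : {set 'I_n} | L \subset Y)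
      moment #|(N |: Y) :\: (N |: L)| * u (N |: L) x =
    \sum_(A : {set 'I_n} | A \subset Y) \sum_(r in Y :\: A)
      (~~ (A \subset below setT r))%:R * (u A x * c A r).
  pose F (A L : {set 'I_n}) := \sum_(r in L :\: A) moment #|Y :\: L| *
    ((~~ (A \subset below setT r))%:R * (u A x * u (L :\: A) r)).
  transitivity (\sum_(L : {set 'I_n} | L \subset Y)
                 \sum_(A : {set 'I_n} | A \subset L) F A L).
    apply: eq_bigr => L LY; rewrite urec //; last first.
      by move=> y yL; apply: YN; apply: (subsetP LY).
    have -> : (N |: Y) :\: (N |: L) = Y :\: L.
      by rewrite -setDDl setU1K //.
    by rewrite mulr_sumr; apply: eq_bigr => A AL; rewrite mulr_sumr.
  rewrite big_subset_subset; apply: eq_bigr => A AY; rewrite /F.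
  transitivity (\sum_(R : {set 'I_n} | R \subset Y :\: A) \sum_(r in Y :\: A)
      (~~ (A \subset below setT r))%:R * (u A x *
         (moment #|(Y :\: A) :\: R| * u R r))).
    apply: eq_bigr => R RY; rewrite -setDDl.
    have -> : (A :|: R) :\: A = R.
      rewrite setDUl setDv set0U; apply/setDidPl.
      by move: RY; rewrite subsetD => /andP[].
    rewrite [RHS](big_setID R) /= (setIidPr RY) [X in _ = _ + X]big1 ?addr0.
      by apply: eq_bigr => r _; ring.
    by move=> r; rewrite inE => /andP[rR _]; rewrite (u0 R r rR) !mulr0.
  rewrite exchange_big /=; apply: eq_bigr => r rA.
  by rewrite -!mulr_sumr IHm.
rewrite -big_split /=.
(* The descending pairs cancel. In the remaining ones [A] lies below [r], so deleting it does not
   change the letters above [r]. *)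
transitivity (- \sum_(A : {set 'I_n} | A \subset Y)
  \sum_(r in Y | A \subset below Y r)
     moment #|above Y r| * (moment #|below Y r :\: A| * u A x)).
  rewrite -sumrN; apply: eq_bigr => A AY; rewrite -big_split -sumrN /=.
  rewrite [LHS]big_mkcond [RHS]big_mkcond; apply: eq_bigr => r _.
  have -> : (A \subset below Y r) = (A \subset below setT r).
    apply/subsetP/subsetP => sA y yA; have := sA y yA; rewrite !inE.
      by case/andP.
    by rewrite (subsetP AY y yA).
  rewrite inE; case: (boolP (r \in Y)) => rY; rewrite ?andbF //= andbT.
  case: (boolP (A \subset below setT r)) => Ar /=; last first.
    by case: ifP => _ //; rewrite mul1r addNr.
  have rA : r \notin A.
    by apply/negP => /(subsetP Ar); rewrite inE ltnn andbF.
  rewrite rA /c.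
  have -> : below (Y :\: A) r = below Y r :\: A.
    by apply/setP => y; rewrite !inE andbA.
  have -> : above (Y :\: A) r = above Y r.
    apply/setP => y; rewrite !inE; case: (boolP (y \in A)) => //= /(subsetP Ar).
    by rewrite !inE /= ltnNge => /negbTE yr; rewrite ltnNge ltnW ?andbF // ltnNge yr.
  by ring.
rewrite (exchange_big_dep (fun r => r \in Y)) /=; last by move=> ? ? _ /andP[].
(* On the right, [N] adds one letter above [x], so that moment too expands by the Catalan
   recurrence, as a sum over the [r] above [x]. *)
rewrite above_setU1_max // below_setU1_max // cardsU1.
rewrite [N \in _]inE (negbTE NY) /= add1n -[moment _.+1]opprK -sum_moment_rank.
rewrite mulrN; congr (- _).
rewrite mulr_sumr [LHS]big_mkcond [RHS]big_mkcond /=; apply: eq_bigr => r _.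
rewrite inE; case: (boolP (r \in Y)) => //= rY.
have Yr : below Y r \subset Y by apply/subsetP => y; rewrite inE => /andP[].
have -> : \sum_(A : {set 'I_n} | (A \subset Y) && ((A \subset below Y r)))
    moment #|above Y r| * (moment #|below Y r :\: A| * u A x) =
    moment #|above Y r| *
    \sum_(A : {set 'I_n} | A \subset below Y r) (moment #|below Y r :\: A| * u A x).
  rewrite mulr_sumr; apply: eq_bigl => A.
  by case: (boolP (A \subset below Y r)) => [/subset_trans->|]; rewrite ?andbF.
(* If [x < r] fails, [x] lies in no subset [A] of [below Y r] and all terms vanish. *)
case: ifP => xr; last first.
  rewrite big1 ?mulr0 // => A Ar; rewrite u0 ?mulr0 //.
  by apply/negP => /(subsetP Ar); rewrite inE xr andbF.
rewrite IHm ?inE ?xY //; last first.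
  by apply: leq_ltn_trans ltYm; apply: subset_leq_card.
have -> : below (below Y r) x = below Y x.
  apply/setP => y; rewrite !inE; case: (y \in Y) => //=.
  by case: (boolP (y < x)%N) => [yx|]; rewrite ?andbF // (ltn_trans yx).
have -> : above (below Y r) x = below (above Y x) r.
  by apply/setP => y; rewrite !inE -!andbA (andbC (y < r)%N).
have -> : above (above Y x) r = above Y r.
  apply/setP => y; rewrite !inE; case: (y \in Y) => //=.
  by case: (boolP (r < y)%N) => [ry|]; rewrite ?andbF // (ltn_trans xr ry).
by ring.
Qed.

(** * Counting good words *)

Lemma mem_good_words n (X : {set 'I_n}) (w : seq nat) :
  (w \in good_words X) = good w && perm_eq w (letters X).
Proof. by rewrite mem_filter mem_permutations. Qed.

Lemma uniq_good_words n (X : {set 'I_n}) : uniq (good_words X).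
Proof. by rewrite filter_uniq ?permutations_uniq. Qed.

Lemma good_words_mem n (X : {set 'I_n}) (w : seq nat) (i : 'I_n) :
  w \in good_words X -> (i.+1 \in w) = (i \in X).
Proof. by rewrite mem_good_words => /andP[_ /perm_mem->]; rewrite mem_letters. Qed.

Lemma good_words_letter n (X : {set 'I_n}) (w : seq nat) (a : nat) :
  w \in good_words X -> a \in w -> exists2 i : 'I_n, i \in X & a = i.+1.
Proof.
rewrite mem_good_words => /andP[_ /perm_mem->] /mapP[i]; rewrite mem_enum.
by exists i.
Qed.

Lemma good_wordsI n (X : {set 'I_n}) (w : seq nat) :
  good w -> uniq w -> {in w, forall a, exists i : 'I_n, a = i.+1} ->
  (forall i : 'I_n, (i.+1 \in w) = (i \in X)) -> w \in good_words X.
Proof.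
move=> gw uw lw wX; rewrite mem_good_words gw /=.
apply: uniq_perm; rewrite ?uniq_letters // => a.
apply/idP/idP => [aw|/mapP[i]].
  by have [i Ea] := lw a aw; rewrite Ea mem_letters -wX -Ea.
by rewrite mem_enum -wX => ? ->.
Qed.

Lemma good_words_good n (X : {set 'I_n}) (w : seq nat) :
  w \in good_words X -> good w.
Proof. by rewrite mem_good_words => /andP[]. Qed.

Lemma good_words_uniq n (X : {set 'I_n}) (w : seq nat) :
  w \in good_words X -> uniq w.
Proof. by rewrite mem_good_words => /andP[_ /perm_uniq->]; apply: uniq_letters. Qed.

Lemma head_mem (w : seq nat) : w <> [::] -> head 0%N w \in w.
Proof. by case: w => // x w _; apply: mem_head. Qed.

Lemma last_mem (w : seq nat) : w <> [::] -> last 0%N w \in w.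
Proof. by case: w => // x w _; apply: mem_last. Qed.

Lemma good_words_head n (X : {set 'I_n}) (w : seq nat) :
  w \in good_words X -> exists2 i : 'I_n, i \in X & head 0%N w = i.+1.
Proof.
move=> wX; apply: (good_words_letter wX); apply: head_mem.
exact/good_neq_nil/(good_words_good wX).
Qed.

(* [last 0 w] is the largest letter of [w]. *)
Lemma good_words_lt_last n (X : {set 'I_n}) (w : seq nat) (r : 'I_n) :
  w \in good_words X -> r \notin X ->
  (r.+1 < last 0 w)%N = ~~ (X \subset below setT r).
Proof.
move=> wX rX; have gw := good_words_good wX.
have w0 := good_neq_nil gw.
have maxw := ss_image_last (good_words_uniq wX) w0 (good_ss_image gw).
apply/idP/subsetPn => [|[i iX]].
  have [i iX ->] := good_words_letter wX (last_mem w0).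
  by rewrite ltnS => ri; exists i => //; rewrite !inE -leqNgt ltnW.
rewrite !inE -leqNgt leq_eqVlt => /predU1P[/val_inj ri|ri].
  by rewrite ri iX in rX.
by apply: (@leq_trans i.+1) => //; apply: maxw; rewrite (good_words_mem _ wX).
Qed.

(** This is [u(X, x)], to which [moment_convolution] is applied. *)
Definition head_count n (X : {set 'I_n}) (x : 'I_n) : int :=
  \sum_(w <- good_words X) (head 0%N w == x.+1)%:R.

Lemma head_count_notin n (X : {set 'I_n}) x : x \notin X -> head_count X x = 0.
Proof.
move=> xX; rewrite /head_count big_seq big1 // => w wX.
have [i iX ->] := good_words_head wX; case: eqP => // -[/val_inj ix].
by rewrite -ix iX in xX.
Qed.

Lemma sum_head n (X : {set 'I_n}) (w : seq nat) (F : nat -> int) :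
  w \in good_words X ->
  \sum_(x in X) F x * (head 0%N w == x.+1)%:R = F (head 0%N w).-1.
Proof.
move=> wX; have [i iX ->] := good_words_head wX.
rewrite (bigD1 i) //= eqxx mulr1 big1 ?addr0 // => j /andP[_ ji].
by rewrite eqSS val_eqE eq_sym (negbTE ji) mulr0.
Qed.

Lemma sum_head_count n (X : {set 'I_n}) :
  \sum_(x in X) head_count X x = (size (good_words X))%:R.
Proof.
rewrite exchange_big /= -sum1_size natr_sum big_seq [RHS]big_seq.
apply: eq_bigr => w wX; rewrite -[RHS](sum_head (fun=> 1) wX).
by apply: eq_bigr => x _; rewrite mul1r.
Qed.

Lemma good_words1 n (N : 'I_n) : good_words [set N] = [:: [:: N.+1]].
Proof.
apply/perm_small_eq => //; apply: uniq_perm; rewrite ?uniq_good_words // => w.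
rewrite mem_good_words inE /letters enum_set1 /=.
apply/andP/eqP => [[_ /perm_small_eq->//]|->].
by rewrite good1 perm_refl.
Qed.

(** A good word ends with its largest letter; having distinct letters, it can start with that letter
    only if it has length one. *)
Lemma head_count_max n (N : 'I_n) (Y : {set 'I_n}) :
  {in Y, forall y : 'I_n, (y < N)%N} -> head_count (N |: Y) N = (Y == set0)%:R.
Proof.
move=> YN; have [->|Y0] := eqVneq Y set0.
  by rewrite setU0 /head_count good_words1 big_seq1 /= eqxx.
rewrite /head_count big_seq big1 // => w wX; case: eqP => // hN; exfalso.
have gw := good_words_good wX; have w0 := good_neq_nil gw.
have uw := good_words_uniq wX.
have maxw := ss_image_last uw w0 (good_ss_image gw).
have NlN : (N.+1 <= last 0 w)%N.
  by apply: maxw; rewrite (good_words_mem _ wX) setU11.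
have [i iX li] := good_words_letter wX (last_mem w0).
have iN : i = N.
  apply/eqP; move: iX; rewrite !inE => /predU1P[->//|/YN].
  by rewrite ltnNge -ltnS -li NlN.
have : size w = #|N |: Y|.
  by move: wX; rewrite mem_good_words => /andP[_ /perm_size->]; rewrite size_letters.
rewrite cardsU1 (max_notin YN) add1n => sw.
case: w hN li uw sw {wX gw w0 maxw NlN} => // a [|b w] /= ha hl uw sw.
  by move: Y0; rewrite -card_gt0; case: sw => <-.
by move: uw; rewrite ha -iN -hl mem_last.
Qed.

Lemma letters_setU1_max n (N : 'I_n) (Y : {set 'I_n}) (A B : seq nat) (A0 : {set 'I_n}) :
  N \notin Y -> A0 \subset Y -> perm_eq A (letters A0) ->
  perm_eq B (letters (Y :\: A0)) ->
  perm_eq (A ++ B ++ [:: N.+1]) (letters (N |: Y)).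
Proof.
move=> NY AY pA pB.
apply: (@perm_trans _ (letters A0 ++ letters (Y :\: A0) ++ letters [set N])).
  rewrite /letters enum_set1 /=.
  by apply: perm_cat => //; apply: perm_cat.
rewrite /letters -!map_cat; apply: perm_map; apply: uniq_perm; rewrite ?enum_uniq //.
  rewrite !cat_uniq !enum_uniq /= andbT; apply/andP; split; apply/hasPn => i.
    rewrite mem_cat !mem_enum !inE => /orP[/andP[]//|/eqP->].
    by apply: contra NY; apply: (subsetP AY).
  by rewrite !mem_enum !inE => /eqP->; rewrite (negbTE NY) andbF.
move=> i; rewrite !mem_cat !mem_enum !inE.
case: (boolP (i \in A0)) => [/(subsetP AY)->|_] /=; first by rewrite orbT.
by rewrite orbC.
Qed.

(** The decomposition [A B N] as an enumeration, indexed by the set [A0] of letters of [A]. A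
    nonempty [Y] rules out the one-letter word. *)
Lemma good_words_setU1_max n (N : 'I_n) (Y : {set 'I_n}) :
  {in Y, forall y : 'I_n, (y < N)%N} -> Y != set0 ->
  perm_eq (good_words (N |: Y))
    [seq p.1 ++ p.2 ++ [:: N.+1] | A0 <- enum (powerset Y),
      p <- [seq p <- [seq (A, B) | A <- good_words A0, B <- good_words (Y :\: A0)]
              | (head 0 p.2 < last 0 p.1)%N]].
Proof.
move=> YN Y0; have NY := max_notin YN.
have ltN (X : {set 'I_n}) w : X \subset Y -> w \in good_words X -> all (gtn N.+1) w.
  move=> XY wX; apply/allP => a aw; have [i iX ->] := good_words_letter wX aw.
  by rewrite /= ltnS; apply: YN; apply: (subsetP XY).
have uAB (A0 : {set 'I_n}) (A B : seq nat) : A0 \subset Y ->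
    A \in good_words A0 -> B \in good_words (Y :\: A0) -> uniq (A ++ B).
  move=> AY gA gB; rewrite cat_uniq (good_words_uniq gA) (good_words_uniq gB) andbT /=.
  apply/hasPn => a aB; have [i + Ea] := good_words_letter gB aB.
  by rewrite inE Ea /= (good_words_mem _ gA) => /andP[].
apply: uniq_perm; first exact: uniq_good_words.
  (* No word is listed twice: [good_cat_inj] recovers the two blocks, and the left block determines
     [A0]. *)
  apply: allpairs_uniq_dep; first exact: enum_uniq.
    move=> A0 _; apply: filter_uniq; apply: allpairs_uniq; rewrite ?uniq_good_words //.
    by move=> [? ?] [? ?] _ _ [-> ->].
  move=> [A0 [A B]] [A1 [A' B']].
  case/allpairsPdep=> C0 [[C D] [C0Y + EC]].
  have {EC} := congr1 (fun p => (tag p, (tagged p : seq nat * seq nat))) EC.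
  case=> -> -> ->; rewrite mem_filter => /andP[ltCD].
  case/allpairsP=> -[C_ D_] /= [gC gD [EC ED]].
  rewrite -{}EC -{}ED in gC gD *.
  case/allpairsPdep=> E0 [[E F] [E0Y + EE]].
  have {EE} := congr1 (fun p => (tag p, (tagged p : seq nat * seq nat))) EE.
  case=> -> -> ->; rewrite mem_filter => /andP[ltEF].
  case/allpairsP=> -[E_ F_] /= [gE gF [EE EF]].
  rewrite -{}EE -{}EF in gE gF *.
  rewrite !catA !cats1 => /rcons_inj[Ecat].
  rewrite mem_enum inE in C0Y.
  have [EC ED] := good_cat_inj (uAB _ _ _ C0Y gC gD) (good_words_good gC)
    (good_words_good gD) ltCD (good_words_good gE) (good_words_good gF) ltEF Ecat.
  rewrite -EC -ED; suff -> : C0 = E0 by [].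
  by apply/setP => i; rewrite -(good_words_mem _ gC) -(good_words_mem _ gE) EC.
move=> w; apply/idP/allpairsPdep.
  move=> wX; have gw := good_words_good wX; have uw := good_words_uniq wX.
  have [[a Ew]|[A [B [M [Ew gA gB lt /andP[AM BM]]]]]] := good_cases uw gw.
    move: wX; rewrite mem_good_words Ew => /andP[_ /perm_size].
    rewrite size_letters cardsU1 NY add1n => -[/esym/eqP].
    by rewrite cards_eq0 (negbTE Y0).
  have letw a : a \in w -> exists2 i : 'I_n, i \in N |: Y & a = i.+1.
    exact: good_words_letter.
  (* Both are the largest letter of [w]. *)
  have EM : M = N.+1.
    have [|i iX Ei] := letw M; first by rewrite Ew !mem_cat inE eqxx !orbT.
    have : N.+1 \in w by rewrite (good_words_mem _ wX) setU11.
    rewrite Ew !mem_cat inE => /or3P[/(allP AM)|/(allP BM)|/eqP->//];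
      move: iX; rewrite Ei !inE => /predU1P[->|/YN iN] //=;
      by rewrite ltnS ltnNge (ltnW iN).
  rewrite {M}EM in Ew AM BM.
  have uABw : uniq (A ++ B) by move: uw; rewrite Ew catA cats1 rcons_uniq => /andP[].
  have := uABw; rewrite cat_uniq => /and3P[uA /hasPn dAB uB].
  have memY (i : 'I_n) : (i \in Y) = (i.+1 \in A) || (i.+1 \in B).
    have := good_words_mem i wX; rewrite Ew !mem_cat !inE eqSS val_eqE.
    have [->|_] /= := eqVneq i N; last by rewrite orbF.
    rewrite (negbTE NY) => _; apply/esym/norP; split; apply/negP.
      by move=> /(allP AM); rewrite /= ltnn.
    by move=> /(allP BM); rewrite /= ltnn.
  exists [set i : 'I_n | i.+1 \in A], (A, B).
  rewrite mem_enum inE mem_filter lt /=; split=> //.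
    by apply/subsetP => i; rewrite inE memY => ->.
  apply/allpairsP; exists (A, B); split=> //=; apply: good_wordsI => // a.
  - move=> aA; have [|i _ ->] := letw a; last by exists i.
    by rewrite Ew mem_cat aA.
  - by rewrite inE.
  - move=> aB; have [|i _ ->] := letw a; last by exists i.
    by rewrite Ew !mem_cat aB orbT.
  rewrite !inE memY; case: (boolP (a.+1 \in B)) => [/dAB->|]; rewrite ?orbT //.
  by rewrite orbF andNb.
case=> A0 [[A B] [+ + ->]]; rewrite mem_enum inE mem_filter /= => AY /andP[lt].
case/allpairsP=> -[A' B'] /= [gA gB [EA EB]]; rewrite -{}EA -{}EB in gA gB.
rewrite mem_good_words good_cat ?(good_words_good gA) ?(good_words_good gB) //=.
- apply: (letters_setU1_max NY AY).
    by move: gA; rewrite mem_good_words => /andP[].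
  by move: gB; rewrite mem_good_words => /andP[].
- exact: ltN gA.
by apply: ltN gB; apply: subsetDl.
Qed.

(** The word [A B N] starts with the first letter of [A]. Summing over the first letter [r] of [B]
    turns the descent condition, by [good_words_lt_last], into one on the letter set of [A] and [r]
    alone, so the counts of the two blocks factor. *)
Lemma head_count_rec n (N : 'I_n) (Y : {set 'I_n}) x :
  {in Y, forall y : 'I_n, (y < N)%N} -> x != N ->
  head_count (N |: Y) x =
    \sum_(A : {set 'I_n} | A \subset Y) \sum_(r in Y :\: A)
      (~~ (A \subset below setT r))%:R * (head_count A x * head_count (Y :\: A) r).
Proof.
move=> YN xN; have [->|Y0] := eqVneq Y set0.
  rewrite setU0 head_count_notin ?inE //; apply/esym/big1 => A _.
  by rewrite big1 // => r; rewrite !inE andbF.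
rewrite /head_count (perm_big _ (good_words_setU1_max YN Y0)) /=.
rewrite big_allpairs_dep /= big_enum /=.
apply: eq_big => [A|A AY]; rewrite ?inE //.
rewrite big_filter big_mkcond big_allpairs /=.
transitivity (\sum_(w <- good_words A) \sum_(v <- good_words (Y :\: A))
  \sum_(r in Y :\: A) (~~ (A \subset below setT r))%:R *
    ((head 0%N w == x.+1)%:R * (head 0%N v == r.+1)%:R : int)); last first.
  rewrite [RHS](eq_bigr (fun r => \sum_(w <- good_words A)
    \sum_(v <- good_words (Y :\: A)) (~~ (A \subset below setT r))%:R *
    ((head 0%N w == x.+1)%:R * (head 0%N v == r.+1)%:R : int))).
    by rewrite [RHS]exchange_big /=; apply: eq_bigr => w _; rewrite exchange_big.
  move=> r _; rewrite mulr_suml mulr_sumr; apply: eq_bigr => w _.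
  by rewrite !mulr_sumr.
rewrite big_seq [RHS]big_seq; apply: eq_bigr => w wA.
rewrite big_seq [RHS]big_seq; apply: eq_bigr => v vA.
have [i iA hv] := good_words_head vA.
have -> : head 0%N (w ++ v ++ [:: N.+1]) = head 0%N w.
  by case: (w) (good_neq_nil (good_words_good wA)).
rewrite (bigD1 i) //= hv eqxx mulr1 big1 ?addr0 => [|j /andP[_ ji]]; last first.
  by rewrite eqSS val_eqE [i == j]eq_sym (negbTE ji) !mulr0.
rewrite (good_words_lt_last wA); last by move: iA; rewrite inE => /andP[].
by case: ifP; rewrite ?mul1r ?mul0r.
Qed.

(** * Lassalle's recurrence *)

(** Sum [moment_convolution] for [head_count] over all first letters; [sum_moment_rank] evaluates
    the right-hand side. *)
Lemma good_words_convolution n (X : {set 'I_n}) :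
  \sum_(L : {set 'I_n} | L \subset X) moment #|X :\: L| * (size (good_words L))%:R =
  - moment #|X|.+1.
Proof.
rewrite -sum_moment_rank.
transitivity (\sum_(r in X) \sum_(L : {set 'I_n} | L \subset X)
   moment #|X :\: L| * head_count L r).
  rewrite exchange_big /=; apply: eq_bigr => L LX; rewrite -sum_head_count -mulr_sumr.
  congr (_ * _); rewrite [RHS](big_setID L) /= (setIidPr LX).
  rewrite [X in _ = _ + X]big1 ?addr0 // => r; rewrite inE => /andP[rL _].
  exact: head_count_notin.
apply: eq_bigr => r rX; apply: moment_convolution => //.
- exact: head_count_notin.
- exact: head_count_max.
exact: head_count_rec.
Qed.

Lemma sum_subset_card (T : finType) (X : {set T}) (g : nat -> int) :
  \sum_(L : {set T} | L \subset X) g #|X :\: L| =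
  \sum_(i < #|X|.+1) 'C(#|X|, i)%:R * g i.
Proof.
have lt (L : {set T}) : (#|X :\: L| < #|X|.+1)%N.
  by rewrite ltnS subset_leq_card // subsetDl.
rewrite (partition_big (fun L : {set T} => Ordinal (lt L)) xpredT) //=.
apply: eq_bigr => i _; rewrite (eq_bigr (fun=> g i)); last first.
  by move=> L /andP[_ /eqP <-].
rewrite sumr_const mulr_natl -bin_sub ?leq_ord // -cards_draws; congr (_ *+ _).
apply: eq_card => L; rewrite !inE unfold_in; case: (boolP (L \subset X)) => //= LX.
rewrite -val_eqE /= cardsD (setIidPr LX).
have := subset_leq_card LX; have := leq_ord i.
by move=> le1 le2; apply/eqP/eqP => [<-|->]; rewrite subKn.
Qed.

(** Isolate [L = X] in [good_words_convolution]. As odd moments vanish, only [L] of odd size remain,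
    which induction covers, and [- moment k.+1.*2] is the leading Catalan term of [lassalleE]. *)
Lemma size_good_words n (X : {set 'I_n}) k : #|X| = k.*2.+1 ->
  Posz (size (good_words X)) = lassalle k.+1.
Proof.
elim/ltn_ind: k X => k IHk X cX.
(* [g i] is the contribution of a proper subset [L] with [i = #|X :\: L|]. The value 0 at [i = 0]
   lets [L = X] rejoin the sum, so that [sum_subset_card] applies. *)
pose g i := moment i * (if i == 0%N then 0 else lassalle (k.+1 - i./2)).
have := good_words_convolution X; rewrite (bigD1 X) //= setDv cards0 mul1r.
rewrite (_ : \sum_(_ | _) _ =
  \sum_(L : {set 'I_n} | L \subset X) g #|X :\: L|); last first.
  rewrite [RHS](bigD1 X) //= setDv cards0 {1}/g eqxx mulr0 add0r.
  apply: eq_bigr => L /andP[LX LnX]; rewrite /g.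
  have LX' : L \proper X by rewrite properEneq LnX.
  have cL := proper_card LX'.
  have -> : #|X :\: L| = (#|X| - #|L|)%N by rewrite cardsD (setIidPr LX).
  rewrite subn_eq0 leqNgt cL /=.
  have [o|e] := boolP (odd (#|X| - #|L|)); first by rewrite moment_odd // !mul0r.
  congr (_ * _); rewrite cX in cL e *.
  have E : #|L| = (#|L|./2).*2.+1 by lia.
  rewrite natz (IHk _ _ L E); last by lia.
  congr lassalle; rewrite {2}E subSS -doubleB doubleK; move: #|L| E cL {e} => l E cL.
  by move: cL; rewrite E; move: l./2 => j; lia.
rewrite sum_subset_card cX big_ord_recr /=.
(* The last index corresponds to the empty [L], and its moment is odd. *)
rewrite [g k.*2.+1]/g moment_odd ?mul0r ?mulr0 ?addr0; last by rewrite /= odd_double.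
rewrite (sum_even_index (F := fun i => 'C(k.*2.+1, i)%:R * g i)); last first.
  by move=> i oi; rewrite /g moment_odd // mul0r mulr0.
rewrite -doubleS moment_double natz => /(canRL (addrK _)) ->.
rewrite lassalleE // big_add1 /= big_mkord big_ord_recl.
rewrite {1}/g eqxx !mulr0 add0r subn1 /= exprS mulN1r mulNr opprK -sumrN.
congr (_ + _); apply: eq_bigr => i _.
rewrite /g moment_double doubleK.
have -> : 'C(2 * k.+1 - 1, 2 * k.+1 - 2 * i.+1 - 1) = 'C(k.*2.+1, i.+1.*2).
  rewrite -bin_sub; last by have := ltn_ord i; lia.
  by have := ltn_ord i => lt_ik; congr 'C(_, _); lia.
rewrite /= /bump /= add1n subn1 exprS natz.
by ring.
Qed.

Local Close Scope ring_scope.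

Theorem mainTheorem1 (k : nat) :
  Posz #|[set p : 'S_(2 * k + 1) | uniquely_sorted p]| = lassalle (k + 1).
Proof.
rewrite card_uniquely_sorted ?addn1 // (@size_good_words _ _ k) //.
by rewrite cardsT card_ord mul2n.
Qed.
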